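(* Let $X=[0,1]$, $S=[\underline s,\bar s]$, $\bar u\in\mathcal{K}(X)$ with $\partial\bar u(X)\subseteq S$, and let $\mu,\nu$ be finite signed Radon measures on $X$, where $\mu$ admits a density on $(0,1)$, i.e. $\mu(A)=\int_A\psi\,\mathrm{d}(\delta_1-\delta_0+\lambda)$ for an integrable $\psi$ ($\lambda$ Lebesgue measure). Then: (1) If $\bar u'\equiv\bar s$ on $X$, there is a selection $\underline u\mapsto u_{\underline u}\in\arg\max_{u\in\mathcal{U}_{\underline u}}\int_X u\,\mathrm{d}\mu$ defined on $\mathcal{K}^0_{\bar u,S}$ which is linear in the sense that $u_{\alpha\underline u_1+(1-\alpha)\underline u_2}=\alpha u_{\underline u_1}+(1-\alpha)u_{\underline u_2}$ for all $\underline u_1,\underline u_2\in\mathcal{K}^0_{\bar u,S}$, $\alpha\in[0,1]$; in particular $V(\underline u)=\int_X u_{\underline u}\,\mathrm{d}\nu$ is affine on $\mathcal{K}^0_{\bar u,S}$. (2) Symmetrically, if $\bar u'\equiv\underline s$ on $X$, the same conclusion holds on $\mathcal{K}^1_{\bar u,S}$. (3) If $\nu=\mu$, then $V(\underline u)=\max_{u\in\mathcal{U}_{\underline u}}\int_X u\,\mathrm{d}\mu$ is concave on $\mathcal{K}_{\bar u,S}$.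
   Context: $\mathcal{K}(X)$ is the set of continuous convex functions on $X$; $\partial u(X)=\bigcup_{x\in\mathrm{int}X}\partial u(x)$ (subdifferentials). $\mathcal{K}_{\bar u,S}=\{u\in\mathcal{K}(X): u\le\bar u,\ \partial u(X)\subseteq S\}$; $\mathcal{K}^0_{\bar u,S}=\{u\in\mathcal{K}_{\bar u,S}: u(0)=\bar u(0)\}$; $\mathcal{K}^1_{\bar u,S}=\{u\in\mathcal{K}_{\bar u,S}: u(1)=\bar u(1)\}$. For $\underline u\in\mathcal{K}_{\bar u,S}$, $\mathcal{U}_{\underline u}=\{u\in\mathcal{K}_{\bar u,S}: u\ge\underline u\}$ (a convex function interval with lower boundary $\underline u$). *)

(* Defs.v *)
From HB Require Import structures.
From mathcomp Require Import all_boot all_order all_algebra.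
From mathcomp Require Import all_classical all_reals all_analysis.
Set Implicit Arguments. Unset Strict Implicit. Unset Printing Implicit Defensive.
Import Order.TTheory GRing.Theory Num.Theory.
Import numFieldNormedType.Exports.
Local Open Scope classical_set_scope.
Local Open Scope ring_scope.

Section Defs.
Variable R : realType.

Definition X : set R := `[0, 1]%classic.

Definition convex_on_X (u : R -> R) : Prop :=
  forall x y t, x \in `[0, 1] -> y \in `[0, 1] -> t \in `[0, 1] ->
    u (t * x + (1 - t) * y) <= t * u x + (1 - t) * u y.

Definition KX (u : R -> R) : Prop :=
  {within X, continuous u} /\ convex_on_X u.

Definition subdiff (u : R -> R) (x : R) : set R :=
  [set p | forall y, y \in `[0, 1] -> u x + p * (y - x) <= u y].

Definition subdiff_in (u : R -> R) (slo shi : R) : Prop :=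
  forall x p, x \in `]0, 1[ -> subdiff u x p -> slo <= p <= shi.

Definition Kset (ubar : R -> R) (slo shi : R) (u : R -> R) : Prop :=
  KX u /\ (forall x, x \in `[0, 1] -> u x <= ubar x) /\ subdiff_in u slo shi.

Definition Kset0 ubar slo shi (u : R -> R) : Prop :=
  Kset ubar slo shi u /\ u 0 = ubar 0.

Definition Kset1 ubar slo shi (u : R -> R) : Prop :=
  Kset ubar slo shi u /\ u 1 = ubar 1.

Definition Uset ubar slo shi (ulo u : R -> R) : Prop :=
  Kset ubar slo shi u /\ (forall x, x \in `[0, 1] -> ulo x <= u x).

(* integral of u against the signed measure mu = psi d(delta_1 - delta_0 + lambda) *)
Definition int_mu (psi : R -> R) (u : R -> R) : R :=
  u 1 * psi 1 - u 0 * psi 0 +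
  Rintegral lebesgue_measure `[0, 1] (fun x => u x * psi x).

(* integral of u against the signed measure nu = nup - num (Jordan decomposition),
   restricted to X *)
Definition int_nu (nup num : {finite_measure set R -> \bar R}) (u : R -> R) : R :=
  Rintegral nup `[0, 1] u - Rintegral num `[0, 1] u.

Definition is_argmax ubar slo shi psi (ulo u : R -> R) : Prop :=
  Uset ubar slo shi ulo u /\
  forall v, Uset ubar slo shi ulo v -> int_mu psi v <= int_mu psi u.

Definition cvxc (a : R) (f g : R -> R) : R -> R :=
  fun x => a * f x + (1 - a) * g x.

Definition linear_selection ubar slo shi psi
  (nup num : {finite_measure set R -> \bar R}) (K' : (R -> R) -> Prop) : Prop :=
  exists sel : (R -> R) -> (R -> R),
    (forall ulo, K' ulo -> is_argmax ubar slo shi psi ulo (sel ulo)) /\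
    (forall ulo1 ulo2 a, K' ulo1 -> K' ulo2 -> a \in `[0, 1] ->
       forall x, x \in `[0, 1] ->
         sel (cvxc a ulo1 ulo2) x = cvxc a (sel ulo1) (sel ulo2) x) /\
    (forall ulo1 ulo2 a, K' ulo1 -> K' ulo2 -> a \in `[0, 1] ->
       int_nu nup num (sel (cvxc a ulo1 ulo2)) =
         a * int_nu nup num (sel ulo1) + (1 - a) * int_nu nup num (sel ulo2)).

End Defs.

(* Main.v *)
(* The constraint set depends on u only through convexity and the slope bounds, so
   all functions involved are Lipschitz with a common constant, and int_mu is
   uniformly approximated by weighted sums of values on a finite grid.
   For such a sum an optimal selection is explicit: a grid point of positive weight
   is raised onto the chord of its neighbours (or onto a ray of extreme slope, at
   the free end of the interval), which eliminates it and redistributes its weight;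
   once all remaining weights are nonpositive, the lower bound itself is optimal.
   The chords depend on the weights only, hence the selection is linear.  A
   pointwise limit along an ultrafilter of the grid selections is again linear, and
   it is optimal for int_mu.  The same limit, applied to a maximizing sequence,
   gives the existence of a maximum for a general upper bound; concavity in (3)
   follows because convex combinations of feasible functions are feasible. *)
Require Import Defs.
From HB Require Import structures.
From mathcomp Require Import all_boot all_order all_algebra.
From mathcomp Require Import all_classical all_reals all_analysis.
From mathcomp Require Import measurable_realfun.
From mathcomp Require Import ring lra zify.
Import Order.TTheory GRing.Theory Num.Theory.
Import numFieldNormedType.Exports.
Local Open Scope classical_set_scope.
Local Open Scope ring_scope.
Set Implicit Arguments.
Unset Strict Implicit.
Unset Printing Implicit Defensive.

(** * Convex functions with slopes in [[slo, shi]], and the two operations that raise them *)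

Section Admissible.
Context {R : realType}.
Implicit Types (u v f g : R -> R) (slo shi : R).

(** A form of the constraints (see [KsetP]) made of inequalities between values at points of
    [[0, 1]], endpoints included, hence closed under pointwise limits. *)
Definition admissible slo shi u : Prop :=
  convex_on_X u /\
  forall x y, 0 <= x -> x <= y -> y <= 1 ->
    slo * (y - x) <= u y - u x <= shi * (y - x).

Lemma admissible_max slo shi u v : admissible slo shi u -> admissible slo shi v ->
  admissible slo shi (fun x => Num.max (u x) (v x)).
Proof.
move=> [cu su] [cv sv]; split=> [x y t x01 y01 t01|x y x0 xy y1].
  have := cu x y t x01 y01 t01; have := cv x y t x01 y01 t01.
  move: t01; rewrite in_itv/= => /andP[t0 t1].
  have [] := leP (u x) (v x); have [] := leP (u y) (v y);
  have [] := leP (u (t * x + (1 - t) * y)) (v (t * x + (1 - t) * y)); nra.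
have := su x y x0 xy y1; have := sv x y x0 xy y1.
have [] := leP (u x) (v x); have [] := leP (u y) (v y); nra.
Qed.

Lemma admissible_affine slo shi c m a : slo <= m <= shi ->
  admissible slo shi (fun x => c + m * (x - a)).
Proof.
by move=> /andP[sm ms]; split=> [x y t _ _ _|x y x0 xy y1]; [lra|nra].
Qed.

Lemma admissible_cvxc slo shi a u v : a \in `[0, 1] ->
  admissible slo shi u -> admissible slo shi v ->
  admissible slo shi (cvxc a u v).
Proof.
rewrite in_itv/= => /andP[a0 a1] [cu su] [cv sv].
split=> [x y t x01 y01 t01|x y x0 xy y1]; rewrite /cvxc.
  have := cu x y t x01 y01 t01; have := cv x y t x01 y01 t01; nra.
have := su x y x0 xy y1; have := sv x y x0 xy y1; nra.
Qed.

Lemma convex_three_points u x y z : convex_on_X u ->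
  0 <= x -> x <= y -> y <= z -> z <= 1 ->
  (z - x) * u y <= (z - y) * u x + (y - x) * u z.
Proof.
move=> cu x0 xy yz z1; have [xz|zx] := ltP x z; last first.
  by have -> : y = x by [lra]; have -> : z = x by [lra]; lra.
have zx0 : 0 < z - x by rewrite subr_gt0.
set w := (z - y) / (z - x).
have wE : w * (z - x) = z - y by rewrite divfK// gt_eqF.
have := cu x z w; rewrite !in_itv/= => /(_ ltac:(lra) ltac:(lra)).
rewrite divr_ge0 ?ler_pdivrMr ?subr_ge0//= => [/(_ ltac:(lra))|]; last lra.
have -> : w * x + (1 - w) * z = y by nra.
rewrite -(ler_pM2l zx0) => /le_trans; apply.
have -> : y - x = (z - x) - w * (z - x) by rewrite wE; ring.
by rewrite -wE; lra.
Qed.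

Definition chord (a b : R) u : R -> R :=
  fun x => u a + (u b - u a) / (b - a) * (x - a).

(** Written as a maximum so that admissibility is immediate. By convexity the chord wins exactly
    between [a] and [b], up to ties. *)
Definition fill a b u : R -> R := fun x => Num.max (u x) (chord a b u x).

Lemma fill_out a b u x : convex_on_X u ->
  0 <= a -> a < b -> b <= 1 -> 0 <= x <= 1 -> x <= a \/ b <= x ->
  fill a b u x = u x.
Proof.
move=> cu a0 ab b1 /andP[x0 x1] xab; apply: max_idPl; rewrite /chord.
set m := _ / _; have mE : m * (b - a) = u b - u a.
  by rewrite /m divfK// subr_eq0 gt_eqF.
rewrite -(ler_pM2l (_ : 0 < b - a)) ?subr_gt0//.
have [xa|bx] := xab.
  have := @convex_three_points u x a b cu; nra.
have := @convex_three_points u a b x cu; nra.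
Qed.

Lemma fill_in a b u x : convex_on_X u ->
  0 <= a -> a < b -> b <= 1 -> a <= x <= b ->
  fill a b u x = chord a b u x.
Proof.
move=> cu a0 ab b1 /andP[x0 x1]; apply: max_idPr; rewrite /chord.
set m := _ / _; have mE : m * (b - a) = u b - u a.
  by rewrite /m divfK// subr_eq0 gt_eqF.
rewrite -(ler_pM2l (_ : 0 < b - a)) ?subr_gt0//.
have := @convex_three_points u a x b cu; nra.
Qed.

Lemma admissible_fill slo shi a b u : 0 <= a -> a < b -> b <= 1 ->
  admissible slo shi u -> admissible slo shi (fill a b u).
Proof.
move=> a0 ab b1 au; apply: admissible_max => //; apply: admissible_affine.
have [_ /(_ a b a0 (ltW ab) b1)] := au.
by rewrite ler_pdivlMr ?ler_pdivrMr ?subr_gt0.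
Qed.

(** The maximum is not linear in general, but here the winning branch depends on [x] alone and not
    on the function, and each branch is linear. *)
Lemma fill_cvxc slo shi a b t u v : 0 <= a -> a < b -> b <= 1 ->
  t \in `[0, 1] -> admissible slo shi u -> admissible slo shi v ->
  {in `[0, 1], fill a b (cvxc t u v) =1 cvxc t (fill a b u) (fill a b v)}.
Proof.
move=> a0 ab b1 t01 au av x; rewrite in_itv/= => x01.
have auv := admissible_cvxc t01 au av.
have ba0 : b - a != 0 by rewrite subr_eq0 gt_eqF.
have [xa|ax] := leP x a.
  by rewrite /cvxc !fill_out//; [exact: av.1|left|exact: au.1|left|exact: auv.1|left].
have [bx|xb] := leP b x.
  by rewrite /cvxc !fill_out//; [exact: av.1|right|exact: au.1|right|exact: auv.1|right].
have axb : a <= x <= b by rewrite !ltW.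
rewrite /cvxc !fill_in//; [|exact: av.1|exact: au.1|exact: auv.1].
by rewrite /chord; field.
Qed.

(** For [m = shi] the slope bounds put the line below [u] to the left of [a] and above it to the
    right, so again the branch depends on [x] only. *)
Definition ray a (m : R) u : R -> R := fun x => Num.max (u x) (u a + m * (x - a)).

Lemma ray_left slo shi a u x : admissible slo shi u -> a <= 1 -> 0 <= x <= a ->
  ray a shi u x = u x.
Proof.
move=> [_ su] a1 /andP[x0 xa]; apply: max_idPl.
by have := su x a x0 xa a1; lra.
Qed.

Lemma ray_right slo shi a u x : admissible slo shi u -> 0 <= a -> a <= x <= 1 ->
  ray a shi u x = u a + shi * (x - a).
Proof.
move=> [_ su] a1 /andP[ax x1]; apply: max_idPr.
by have := su a x a1 ax x1; lra.
Qed.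

Lemma admissible_ray slo shi a u : slo <= shi ->
  admissible slo shi u -> admissible slo shi (ray a shi u).
Proof.
by move=> ss au; apply: admissible_max => //; apply: admissible_affine; rewrite ss/=.
Qed.

Lemma ray_cvxc slo shi a t u v : 0 <= a -> a <= 1 ->
  t \in `[0, 1] -> admissible slo shi u -> admissible slo shi v ->
  {in `[0, 1], ray a shi (cvxc t u v) =1 cvxc t (ray a shi u) (ray a shi v)}.
Proof.
move=> a0 a1 t01 au av x; rewrite in_itv/= => /andP[x0 x1].
have auv := admissible_cvxc t01 au av.
have [xa|ax] := leP x a; rewrite /cvxc.
  have xa' : 0 <= x <= a by rewrite x0.
  by rewrite (ray_left auv)// (ray_left au)// (ray_left av).
have ax' : a <= x <= 1 by rewrite x1 ltW.
by rewrite (ray_right auv)// (ray_right au)// (ray_right av)// /cvxc; ring.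
Qed.

End Admissible.

(** * Linear optimal selections for weighted sums of point values *)

Section DiscreteSelection.
Context {R : realType}.
Implicit Types (u v f g : R -> R) (slo shi z : R) (L : (R -> R) -> R)
  (T : (R -> R) -> (R -> R)).

Definition raising slo shi z T : Prop :=
  (forall u, admissible slo shi u ->
     [/\ admissible slo shi (T u), T u z = u z &
         forall x, x \in `[0, 1] -> u x <= T u x]) /\
  (forall t u v, t \in `[0, 1] -> admissible slo shi u -> admissible slo shi v ->
     {in `[0, 1], T (cvxc t u v) =1 cvxc t (T u) (T v)}).

(** The upper bound [ubar] is replaced by pinning the competitor at the endpoint [z]; in cases (1)
    and (2) the pinning forces the bound. *)
Definition optimal_raising slo shi z L T : Prop :=
  raising slo shi z T /\
  (forall u v, admissible slo shi u -> admissible slo shi v -> v z = u z ->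
     (forall x, x \in `[0, 1] -> u x <= v x) -> L v <= L (T u)).

(** One elimination step: [L'] is [L] with a node removed, [L <= L' + K] always holds, and [P] makes
    up the gap. Hence [L v <= L' v + K <= L' (T u) + K <= L (P (T u))]. Since [T] is linear on
    [[0, 1]] only, [P] has to respect equality there. *)
Lemma optimal_raising_comp slo shi z L L' (K : R) T P :
  raising slo shi z P ->
  (forall u v, {in `[0, 1], u =1 v} -> {in `[0, 1], P u =1 P v}) ->
  (forall u, admissible slo shi u -> L' u + K <= L (P u)) ->
  (forall u, admissible slo shi u -> L u <= L' u + K) ->
  optimal_raising slo shi z L' T -> optimal_raising slo shi z L (P \o T).
Proof.
move=> [aP lP] eP L'P LL' [[aT lT] oT]; split; first split.
- move=> u au /=; have [aTu Tz uT] := aT u au; have [aPu Pz uP] := aP _ aTu.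
  by split => //; [rewrite Pz|move=> x x01; exact: le_trans (uT _ _) (uP _ _)].
- move=> t u v t01 au av x x01 /=.
  have [aTu _ _] := aT u au; have [aTv _ _] := aT v av.
  by rewrite (eP _ _ (lT t u v t01 au av))//; exact: lP.
- move=> u v au av vz uv; have [aTu _ _] := aT u au.
  by apply: le_trans (LL' _ av) (le_trans _ (L'P _ aTu)); rewrite lerD2r; exact: oT.
Qed.

Lemma raising_fill slo shi (a b : R) : 0 <= a -> a < b -> b <= 1 ->
  raising slo shi 0 (fill a b).
Proof.
move=> a0 ab b1; split; last by move=> t u v t01 au av; exact: (fill_cvxc a0 ab b1 t01 au av).
move=> u au; split; first exact: admissible_fill.
  by apply: fill_out => //; [exact: au.1|rewrite lexx ler01|left].
by move=> x _; rewrite le_max lexx.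
Qed.

Lemma raising_ray slo shi (a : R) : slo <= shi -> 0 <= a -> a <= 1 ->
  raising slo shi 0 (ray a shi).
Proof.
move=> ss a0 a1; split; last by move=> t u v t01 au av; exact: (ray_cvxc a0 a1 t01 au av).
move=> u au; split; first exact: admissible_ray.
  by rewrite (ray_left au)// lexx.
by move=> x _; rewrite le_max lexx.
Qed.

Definition point_sum (p : seq (R * R)) u : R := \sum_(q <- p) q.2 * u q.1.

Let before (q r : R * R) := q.1 < r.1.

(* A node of positive weight wants to be raised as much as convexity allows, i.e.
   onto the chord of its neighbours (or, for the last node, onto the ray of slope
   [shi]); it can thus be eliminated, its weight being shared by its neighbours. *)
Lemma point_sum_optimal_raising slo shi (p : seq (R * R)) c0 :
  slo <= shi -> pairwise before ((0, c0) :: p) -> all (fun q => q.1 <= 1) p ->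
  exists T, optimal_raising slo shi 0 (point_sum ((0, c0) :: p)) T.
Proof.
move=> ss.
(* The induction is on a bound for the number of nodes, over all lists starting at position 0: an
   elimination changes the weights of the neighbours, possibly that of the first node. *)
suff H n P : (size P <= n)%N -> P != [::] ->
    (head (0, 0) P).1 = 0 -> pairwise before P ->
    all (fun q => 0 <= q.1 <= 1) P ->
    exists T, optimal_raising slo shi 0 (point_sum P) T.
  move=> bp p1; apply: (H _ ((0, c0) :: p) (leqnn _)) => //=.
  rewrite lexx ler01/=; apply/allP => q qp; rewrite (allP p1)// andbT.
  by move: bp => /= /andP[/allP/(_ _ qp)/ltW].
elim: n P => [[]//|n IH [//|q0 {}p]]; rewrite ltnS => pn _ q00 bP P01.
have [/hasP[[t c]] tp /= c0'|/hasPn p0] := boolP (has (fun q => 0 < q.2) p); last first.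
  (* All weights after the first are nonpositive, and at the first node, position 0, [u] and [v]
     agree, so the sign of its weight does not matter. *)
  exists id; split; first by split.
  move=> u v au av vu uv; rewrite /= in q00.
  rewrite /point_sum !big_cons q00 vu lerD2l.
  rewrite big_seq [leRHS]big_seq; apply: ler_sum => q qp.
  have q2 : q.2 <= 0 by rewrite leNgt p0.
  apply: ler_wnM2l => //; apply: uv; rewrite in_itv/=.
  by apply: (allP P01); rewrite inE qp orbT.
(* The node [t] of positive weight is not the first one, so it has a left neighbour [a]. *)
have [r [[a ca] [s pE]]] : exists r q s, q0 :: p = r ++ q :: (t, c) :: s.
  case/splitPr: tp => p1 p2.
  exists (belast q0 p1), (last q0 p1), p2.
  by rewrite -cat_cons lastI cat_rcons.
move: pn q00 bP P01; rewrite -ltnS -[(size p).+1]/(size (q0 :: p)) {}pE {q0 p tp}.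
rewrite size_cat /= !addnS !ltnS => sn h0.
rewrite pairwise_cat all_cat /= => /and3P[ra pr /and3P[/andP[at_ sa] st ps]].
move=> /and4P[r01 /andP[a0 a1] /andP[t0 t1] s01].
have rlt q : q \in r -> q.1 < a.
  by move=> qr; move/allrelP: ra => /(_ q (a, ca) qr); rewrite inE eqxx => /(_ isT).
have r1 q : q \in r -> 0 <= q.1 <= 1 by move/(allP r01).
rewrite /before /= in at_.
case: s h0 sn ra sa st ps s01 => [|[b cb] s] /= h0 sn ra sa st ps s01.
  (* Here [t] is the last node: [u t] is at most [u a + shi * (t - a)], with equality after [ray].
     The whole weight moves to [a], and the rise along the ray gives the constant [K]. *)
  have [|||||T oT] := IH (r ++ [:: (a, ca + c)]).
  - by rewrite size_cat/= addn1; lia.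
  - by case: (r).
  - by case: (r) h0.
  - rewrite pairwise_cat pr/= andbT; apply/allrelP => x y xr.
    by rewrite inE => /eqP ->; exact: rlt.
  - by rewrite all_cat r01/= a0 a1.
  exists (ray a shi \o T).
  apply: (optimal_raising_comp (K := c * (shi * (t - a)))) oT.
  - exact: raising_ray.
  - move=> u v uv x x01; rewrite /ray uv// [u a]uv//.
    by rewrite in_itv/= a0.
  - move=> u au; rewrite /point_sum !big_cat !big_cons !big_nil /=.
    rewrite (eq_big_seq (fun q => q.2 * ray a shi u q.1)); last first.
      move=> q qr /=; rewrite (ray_left au)//.
      by case/andP: (r1 _ qr) => -> _/=; rewrite ltW// rlt.
    rewrite (ray_left au) ?a0 ?lexx// (ray_right au)// ?(ltW at_) ?t1//.
    by lra.
  - move=> u [cu su]; rewrite /point_sum !big_cat !big_cons !big_nil /=.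
    by have := su a t a0 (ltW at_) t1; nra.
move: at_ sa st ps s01 => at_ /andP[ab sa] /andP[tb st] /andP[bs ps] /andP[/andP[b0 b1] s01].
rewrite /before /= in ab tb.
have slt q : q \in s -> b < q.1 by move/(allP bs).
have s1 q : q \in s -> 0 <= q.1 <= 1 by move/(allP s01).
(* Barycentric coordinate, [t = (1 - l) * a + l * b]: the weight of [t] is split between [a] and [b]
   in these proportions. *)
pose l := (t - a) / (b - a).
have lE : l * (b - a) = t - a by rewrite /l divfK// gt_eqF// subr_gt0.
have [|||||T oT] := IH (r ++ (a, ca + (1 - l) * c) :: (b, cb + l * c) :: s).
- by rewrite size_cat/=; move: sn; rewrite /= !addnS.
- by case: (r).
- by case: (r) h0.
- rewrite pairwise_cat pr/= bs ps !andbT; apply/andP; split; last first.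
    by rewrite /before/= ab.
  apply/allrelP => x y xr; rewrite !inE => /or3P[/eqP ->|/eqP ->|ys].
  + exact: rlt.
  + by rewrite /before/=; apply: lt_trans ab; exact: rlt.
  + by rewrite /before; apply: lt_trans (slt _ ys); apply: lt_trans ab; exact: rlt.
- by rewrite all_cat r01/= a0 a1 b0 b1.
exists (fill a b \o T); apply: (optimal_raising_comp (K := 0)) oT.
- exact: raising_fill.
- move=> u v uv x x01; rewrite /fill /chord uv// [u a]uv ?[u b]uv//.
    by rewrite in_itv/= b0.
  by rewrite in_itv/= a0.
- move=> u [cu su]; rewrite /point_sum !big_cat !big_cons /= addr0.
  rewrite (eq_big_seq (fun q => q.2 * fill a b u q.1)); last first.
    move=> q qr /=; rewrite fill_out//; first exact: r1.
    by left; rewrite ltW// rlt.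
  rewrite (eq_big_seq (r := s) (fun q => q.2 * fill a b u q.1)); last first.
    move=> q qr /=; rewrite fill_out//; first exact: s1.
    by right; rewrite ltW// slt.
  rewrite (fill_out (x := a))// ?a0//; last by left.
  rewrite (fill_out (x := b))// ?b0//; last by right.
  have -> : fill a b u t = u a + l * (u b - u a).
    by rewrite fill_in// ?ltW// /chord /l mulrAC -mulrA mulrC.
  by lra.
- move=> u [cu su]; rewrite /point_sum !big_cat !big_cons /= addr0.
  have H : u t <= (1 - l) * u a + l * u b.
    rewrite -(ler_pM2l (_ : 0 < b - a)) ?subr_gt0//.
    have -> : (b - a) * ((1 - l) * u a + l * u b) =
              (b - a) * u a + l * (b - a) * (u b - u a) by ring.
    rewrite lE; have := convex_three_points cu a0 (ltW at_) (ltW tb) b1.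
    by lra.
  by nra.
Qed.

Lemma grid_optimal_raising0 slo shi n (c : nat -> R) : slo <= shi ->
  exists T, optimal_raising slo shi 0
    (fun u => \sum_(i < n.+2) c i * u (i%:R / n.+1%:R)) T.
Proof.
move=> ss.
pose p := [seq (i%:R / n.+1%:R, c i) | i <- iota 1 n.+1] : seq (R * R).
have [||T oT] := @point_sum_optimal_raising slo shi p (c 0) ss.
- rewrite -(mul0r (n.+1%:R^-1)).
  rewrite -[_ :: _]/(map (fun i : nat => (i%:R / n.+1%:R, c i)) (iota 0 n.+2)).
  rewrite pairwise_map; apply: (@sub_pairwise _ ltn); last first.
    by rewrite -sorted_pairwise; [exact: iota_ltn_sorted|exact: ltn_trans].
  by move=> i j ij; rewrite /before/= ltr_pM2r ?ltr_nat// invr_gt0.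
- apply/allP => q /mapP[i]; rewrite mem_iota => /andP[_ iin] -> /=.
  by rewrite ler_pdivrMr// mul1r ler_nat; lia.
exists T; have -> : (fun u => \sum_(i < n.+2) c i * u (i%:R / n.+1%:R)) =
  point_sum ((0, c 0) :: p); last exact: oT.
apply/funext => u; rewrite /point_sum big_cons big_map.
rewrite -[iota 1 n.+1]/(index_iota 1 n.+2) big_add1.
rewrite -(big_mkord xpredT (fun i : nat => c i * u (i%:R / n.+1%:R))).
by rewrite big_nat_recl// mul0r.
Qed.

Definition flip u : R -> R := fun x => u (1 - x).

Lemma flipK : involutive flip.
Proof. by move=> u; apply/funext => x; rewrite /flip; congr u; ring. Qed.

Lemma admissible_flip slo shi u :
  admissible slo shi u -> admissible (- shi) (- slo) (flip u).
Proof.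
move=> [cu su]; split=> [x y t|x y x0 xy y1]; rewrite /flip.
  move=> x01 y01 t01.
  have -> : 1 - (t * x + (1 - t) * y) = t * (1 - x) + (1 - t) * (1 - y) by ring.
  by apply: cu => //; move: x01 y01; rewrite !in_itv/=; lra.
by have := su (1 - y) (1 - x); lra.
Qed.

(** The reflection [flip] is a linear, order preserving involution that exchanges the endpoints and
    negates slopes, so conjugation by it moves the pinned point from 0 to 1. *)
Lemma optimal_raising_flip slo shi L T :
  optimal_raising (- shi) (- slo) 0 (L \o flip) T ->
  optimal_raising slo shi 1 L (flip \o T \o flip).
Proof.
have flip01 (x : R) : x \in `[0, 1] -> 1 - x \in `[0, 1] by rewrite !in_itv/=; lra.
have E := @admissible_flip slo shi.
have E' u : admissible (- shi) (- slo) u -> admissible slo shi (flip u).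
  by move/admissible_flip; rewrite !opprK.
move=> [[aT lT] oT]; split; first split.
- move=> u au /=; have [aTu Tz uT] := aT _ (E _ au); split; first exact: E'.
    by rewrite /flip subrr Tz /flip subr0.
  move=> x x01; have := uT _ (flip01 _ x01).
  by rewrite /flip; have -> : 1 - (1 - x) = x by ring.
- move=> t u v t01 au av x x01 /=; rewrite /flip.
  exact: (lT t (flip u) (flip v) t01 (E _ au) (E _ av) _ (flip01 _ x01)).
- move=> u v au av vz uv /=; have := oT (flip u) (flip v) (E _ au) (E _ av).
  rewrite /= flipK; apply.
    by rewrite /flip subr0.
  by move=> x x01; exact: uv (flip01 _ x01).
Qed.

Lemma grid_optimal_raising1 slo shi n (c : nat -> R) : slo <= shi ->
  exists T, optimal_raising slo shi 1
    (fun u => \sum_(i < n.+2) c i * u (i%:R / n.+1%:R)) T.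
Proof.
move=> ss; have ss' : - shi <= - slo by rewrite lerN2.
(* The reflection maps the grid to itself, sending index [i] to [n.+1 - i], so the weights are
   reversed. *)
have [T oT] := @grid_optimal_raising0 _ _ n (fun i => c (n.+1 - i)%N) ss'.
exists (flip \o T \o flip); apply: optimal_raising_flip.
set L := _ \o _; have -> // : L = fun u => \sum_(i < n.+2) c (n.+1 - i)%N * u (i%:R / n.+1%:R).
apply/funext => u; rewrite /L/= (reindex_inj rev_ord_inj)/=.
apply: eq_bigr => i _; rewrite subSS /flip natrB -1?ltnS//.
congr (_ * u _); have : n.+1%:R != 0 :> R by [].
by move=> ?; field.
Qed.

End DiscreteSelection.

(** * Integrability and integrals of finite real combinations *)

Section RealIntegrable.
Context d (T : measurableType d) (R : realType) (mu : {measure set T -> \bar R}).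
Context (D : set T) (mD : measurable D).
Implicit Types f g h : T -> R.

Lemma integrable_cmul c f : mu.-integrable D (EFin \o f) ->
  mu.-integrable D (EFin \o (fun x => c * f x)).
Proof.
by move=> fi; have := integrableZl mD c fi; apply: eq_integrable.
Qed.

Lemma integrable_sub f g : mu.-integrable D (EFin \o f) ->
  mu.-integrable D (EFin \o g) -> mu.-integrable D (EFin \o (fun x => f x - g x)).
Proof.
by move=> fi gi; have := integrableB mD fi gi; apply: eq_integrable.
Qed.

Lemma integrable_bmul h f : measurable_fun D h -> [bounded h x | x in D] ->
  mu.-integrable D (EFin \o f) -> mu.-integrable D (EFin \o (fun x => h x * f x)).
Proof.
by move=> mh bh fi; have := integrableMr mD mh bh fi; apply: eq_integrable.
Qed.

Lemma integrable_bigsum (I : Type) (s : seq I) (f : I -> T -> R) :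
  (forall i, mu.-integrable D (EFin \o f i)) ->
  mu.-integrable D (EFin \o (fun x => \sum_(i <- s) f i x)).
Proof.
move=> fi; have := integrable_sum mD s (P := xpredT) (fun i _ => fi i).
by apply: eq_integrable => // x _ /=; rewrite sumEFin.
Qed.

Lemma Rintegral_bigsum (I : Type) (s : seq I) (f : I -> T -> R) :
  (forall i, mu.-integrable D (EFin \o f i)) ->
  Rintegral mu D (fun x => \sum_(i <- s) f i x) = \sum_(i <- s) Rintegral mu D (f i).
Proof.
move=> fi; elim: s => [|i s IH].
  rewrite big_nil; under eq_Rintegral do rewrite big_nil.
  by rewrite Rintegral_cst// mul0r.
under eq_Rintegral do rewrite big_cons.
by rewrite RintegralD//; [rewrite IH big_cons|exact: integrable_bigsum].
Qed.

End RealIntegrable.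

(** * Regularity of admissible functions and grid approximation of [int_mu] *)

Section Integrals.
Context {R : realType}.
Implicit Types (u v psi : R -> R) (slo shi : R).

Lemma admissible_lipschitz slo shi u x y : admissible slo shi u ->
  x \in `[0, 1] -> y \in `[0, 1] -> `|u x - u y| <= (`|slo| + `|shi|) * `|x - y|.
Proof.
move=> [_ su].
wlog xy : x y / x <= y => [H x01 y01|].
  have [xy|/ltW yx] := leP x y; first exact: H.
  by rewrite distrC [`|x - y|]distrC; exact: H.
rewrite !in_itv/= => /andP[x0 x1] /andP[y0 y1].
rewrite distrC [`|x - y|]distrC [X in _ <= _ * X]ger0_norm ?subr_ge0// ler_norml.
have /andP[lo hi] := su x y x0 xy y1.
have := ler_norm shi; have := ler_norm (- slo); rewrite normrN.
have := normr_ge0 slo; have := normr_ge0 shi; nra.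
Qed.

Lemma admissible_continuous slo shi u : admissible slo shi u ->
  {within `[0, 1], continuous u}.
Proof.
move=> au; apply/subspace_continuousP => x x01.
(* Adding 1 keeps the divisor positive when both slope bounds vanish. *)
have C0 : 0 < `|slo| + `|shi| + 1 by rewrite ltr_wpDl// addr_ge0.
apply/cvgrPdist_lt => e e0.
have d0 : 0 < e / (`|slo| + `|shi| + 1) by rewrite divr_gt0.
near=> y.
have y01 : y \in `[0, 1] by near: y; exact: withinT.
apply: le_lt_trans (admissible_lipschitz au x01 y01) _.
have : `|x - y| < e / (`|slo| + `|shi| + 1).
  by near: y; apply: cvg_within; exact: nbhsx_ballx.
rewrite ltr_pdivlMr//; apply: le_lt_trans.
by rewrite mulrC ler_wpM2l// lerDl.
Unshelve. all: by end_near. Qed.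

Lemma admissible_measurable slo shi u : admissible slo shi u ->
  measurable_fun (`[0, 1]%classic : set R) u.
Proof.
by move=> au; apply: subspace_continuous_measurable_fun => //;
  exact: admissible_continuous au.
Qed.

Lemma admissible_bounded slo shi u : admissible slo shi u ->
  [bounded u x | x in `[0, 1]%classic].
Proof.
move=> /admissible_continuous cu.
have [M [Mr HM]] := compact_bounded (continuous_compact cu (@segment_compact R 0 1)).
by exists M; split => // y My x x01; apply: HM => //; exists x.
Qed.

Lemma admissible_integrable slo shi u (nu : {finite_measure set R -> \bar R}) :
  admissible slo shi u -> nu.-integrable `[0, 1] (EFin \o u).
Proof.
move=> au; apply: measurable_bounded_integrable => //.
- by rewrite ltey_eq fin_num_measure.
- exact: admissible_measurable au.
- exact: admissible_bounded au.
Qed.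

Lemma integrable_admissibleM slo shi u psi :
  lebesgue_measure.-integrable `[0, 1] (EFin \o psi) -> admissible slo shi u ->
  lebesgue_measure.-integrable `[0, 1] (EFin \o (fun x => u x * psi x)).
Proof.
move=> ipsi au; apply: integrable_bmul => //.
- exact: admissible_measurable au.
- exact: admissible_bounded au.
Qed.

Lemma int_mu_cvxc slo shi a u v psi :
  lebesgue_measure.-integrable `[0, 1] (EFin \o psi) ->
  admissible slo shi u -> admissible slo shi v ->
  int_mu psi (cvxc a u v) = a * int_mu psi u + (1 - a) * int_mu psi v.
Proof.
move=> ipsi au av; have iu := integrable_admissibleM ipsi au.
have iv := integrable_admissibleM ipsi av.
rewrite /int_mu /cvxc.
under eq_Rintegral do rewrite mulrDl -!mulrA.
rewrite RintegralD//; [|exact: integrable_cmul|exact: integrable_cmul].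
by rewrite !RintegralZl//; ring.
Qed.

Lemma int_nu_cvxc slo shi a u v (nup num : {finite_measure set R -> \bar R}) :
  admissible slo shi u -> admissible slo shi v ->
  int_nu nup num (cvxc a u v) = a * int_nu nup num u + (1 - a) * int_nu nup num v.
Proof.
move=> au av.
have E (nu : {finite_measure set R -> \bar R}) : Rintegral nu `[0, 1] (cvxc a u v) =
    a * Rintegral nu `[0, 1] u + (1 - a) * Rintegral nu `[0, 1] v.
  have iu := @admissible_integrable _ _ _ nu au.
  have iv := @admissible_integrable _ _ _ nu av.
  rewrite /cvxc RintegralD//; [|exact: integrable_cmul|exact: integrable_cmul].
  by rewrite !RintegralZl.
by rewrite /int_nu !E; ring.
Qed.

(** On each cell [u] is replaced by its value at the left end; the common Lipschitz constant bounds
    the error. The weights [c] are chosen before [u] and the slope bounds, so one grid sum serves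
    all admissible functions. *)
Lemma int_mu_grid psi (n : nat) :
  lebesgue_measure.-integrable `[0, 1] (EFin \o psi) ->
  exists c : nat -> R, forall slo shi u, admissible slo shi u ->
    `|int_mu psi u - \sum_(i < n.+2) c i * u (i%:R / n.+1%:R)| <=
    (`|slo| + `|shi|) / n.+1%:R *
      Rintegral lebesgue_measure `[0, 1] (fun x => `|psi x|).
Proof.
move=> ipsi; set N := n.+1%:R : R; have N0 : 0 < N by rewrite ltr0n.
(* Cells are half-open and indices run up to [n.+1]: the last cell meets [[0, 1]] only in the point
   1, which the others miss. *)
pose A (i : nat) := `[i%:R / N, i.+1%:R / N[%classic : set R.
pose d i := Rintegral lebesgue_measure `[0, 1] (fun x => \1_(A i) x * psi x).
have iA i : lebesgue_measure.-integrable `[0, 1] (EFin \o (fun x => \1_(A i) x * psi x)).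
  apply: integrable_bmul => //.
    by apply: measurable_indic; exact: measurable_itv.
  exists 1; split => // M M1 x _ /=; apply: le_trans (ltW M1).
  by rewrite indicE; case: (_ \in _); rewrite ?normr1 ?normr0.
(* The integral of [psi] over the cell, plus the atoms of the measure at the two end nodes. *)
exists (fun i => d i + (i == n.+1)%:R * psi 1 - (i == 0)%:R * psi 0).
move=> slo shi u au; set C := _ + `|shi|.
pose step x := \sum_(i < n.+2) u (i%:R / N) * \1_(A i) x.
have stepE x : x \in `[0, 1] -> exists2 y, y \in `[0, 1] & `|x - y| <= N^-1 /\ step x = u y.
  rewrite in_itv/= => /andP[x0 x1].
  have xN0 : 0 <= x * N by rewrite mulr_ge0// ltW.
  have /andP[kx xk] := truncn_itv xN0; set k := Num.trunc _ in kx xk.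
  have kn : (k < n.+2)%N.
    rewrite ltnS -(ler_nat R); apply: le_trans kx _.
    by rewrite -[leRHS]mul1r ler_wpM2r// ltW.
  exists (k%:R / N).
    by rewrite in_itv/= divr_ge0 ?(ltW N0)//= ler_pdivrMr// mul1r ler_nat -ltnS.
  split.
    have k1 : k%:R / N <= x by rewrite ler_pdivrMr.
    rewrite ger0_norm ?subr_ge0// lerBlDl.
    have -> : k%:R / N + N^-1 = k.+1%:R / N by rewrite -natr1; ring.
    by rewrite ler_pdivlMr// ltW.
  rewrite /step (bigD1 (Ordinal kn))//= big1 => [|i ik].
    rewrite addr0 indicE mem_set ?mulr1//=.
    by rewrite /A /= in_itv/= ler_pdivrMr// ltr_pdivlMr// kx.
  rewrite indicE memNset ?mulr0// /A /= in_itv/= ler_pdivrMr// ltr_pdivlMr//.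
  rewrite -truncn_eq// => /eqP ki; move: ik; apply/negP; rewrite negbK.
  by apply/eqP/val_inj; rewrite /= -ki.
have iuA (i : 'I_n.+2) : lebesgue_measure.-integrable `[0, 1]
    (EFin \o (fun x => u (i%:R / N) * (\1_(A i) x * psi x))).
  exact: integrable_cmul.
have stepM : (fun x => step x * psi x) =
    (fun x => \sum_(i < n.+2) u (i%:R / N) * (\1_(A i) x * psi x)).
  apply/funext => x.
  by rewrite mulr_suml; apply: eq_bigr => i _; rewrite mulrA.
have istep : lebesgue_measure.-integrable `[0, 1] (EFin \o (fun x => step x * psi x)).
  by rewrite stepM; exact: integrable_bigsum.
have sumE : \sum_(i < n.+2) (d i + (i == n.+1 :> nat)%:R * psi 1 - (i == 0 :> nat)%:R * psi 0) *
    u (i%:R / N) = u 1 * psi 1 - u 0 * psi 0 +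
    Rintegral lebesgue_measure `[0, 1] (fun x => step x * psi x).
  have -> : Rintegral lebesgue_measure `[0, 1] (fun x => step x * psi x) =
      \sum_(i < n.+2) d i * u (i%:R / N).
    rewrite stepM Rintegral_bigsum//.
    by apply: eq_bigr => i _; rewrite RintegralZl// mulrC.
  have -> : u 1 * psi 1 = \sum_(i < n.+2) (i == n.+1 :> nat)%:R * psi 1 * u (i%:R / N).
    rewrite (bigD1 ord_max)//= big1 => [|i /negPf]; last first.
      by rewrite -val_eqE /= => ->; rewrite !mul0r.
    by rewrite eqxx divff ?gt_eqF// addr0 mul1r mulrC.
  have -> : u 0 * psi 0 = \sum_(i < n.+2) (i == 0 :> nat)%:R * psi 0 * u (i%:R / N).
    rewrite (bigD1 ord0)//= big1 => [|i /negPf]; last first.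
      by rewrite -val_eqE /= => ->; rewrite !mul0r.
    by rewrite mul0r addr0 mul1r mulrC.
  rewrite -sumrB -big_split/=; apply: eq_bigr => i _.
  by rewrite mulrBl mulrDl; ring.
rewrite {}sumE /int_mu.
set a := Rintegral _ _ _; set b := Rintegral _ _ _.
have -> : u 1 * psi 1 - u 0 * psi 0 + a - (u 1 * psi 1 - u 0 * psi 0 + b) = a - b by ring.
have iu := integrable_admissibleM ipsi au.
rewrite /a /b -RintegralB//.
have mI : measurable (`[0, 1]%classic : set (measurableTypeR R)) by exact: measurable_itv.
have iD := integrable_sub mI iu istep.
apply: le_trans (le_normr_Rintegral mI iD) _.
have inpsi := integrable_norm ipsi.
rewrite -RintegralZl//; apply: le_Rintegral => //.
- exact: integrable_norm iD.
- exact: integrable_cmul.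
- move=> x x01; rewrite -mulrBl normrM ler_wpM2r//.
  have [y y01 [xy ->]] := stepE x x01.
  apply: le_trans (admissible_lipschitz au x01 y01) _.
  by rewrite ler_wpM2l// addr_ge0.
Qed.

End Integrals.

(** * Subdifferential bounds versus slope bounds *)

Section Subgradients.
Context {R : realType}.
Implicit Types (u ubar : R -> R) (slo shi : R).

Lemma subdiff_nonempty u x : convex_on_X u -> x \in `]0, 1[ ->
  exists p, subdiff u x p.
Proof.
rewrite in_itv/= => cu /andP[x0 x1].
(* Left difference quotients. Convexity puts them below all right ones, so their supremum, the left
   derivative, is a subgradient. *)
pose S := [set (u x - u y) / (x - y) | y in `[0, x[].
have Sle y z : 0 <= y < x -> x < z <= 1 -> (u x - u y) / (x - y) <= (u z - u x) / (z - x).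
  move=> /andP[y0 yx] /andP[xz z1].
  rewrite ler_pdivrMr ?subr_gt0// mulrAC ler_pdivlMr ?subr_gt0//.
  by have := convex_three_points cu y0 (ltW yx) (ltW xz) z1; lra.
have S0 : S !=set0 by exists ((u x - u 0) / (x - 0)); exists 0 => //=; rewrite in_itv/= lexx.
have Sub : ubound S ((u 1 - u x) / (1 - x)).
  by move=> s [y /=]; rewrite in_itv/= => y0x <-; apply: Sle => //; rewrite x1 lexx.
exists (sup S) => y; rewrite in_itv/= => /andP[y0 y1].
have [yx|xy|->] := ltgtP y x; last by rewrite subrr mulr0 addr0.
- have : (u x - u y) / (x - y) <= sup S.
    apply: ub_le_sup; first by exists ((u 1 - u x) / (1 - x)).
    by exists y => //=; rewrite in_itv/= y0.
  by rewrite ler_pdivrMr ?subr_gt0//; lra.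
- have : sup S <= (u y - u x) / (y - x).
    apply: ge_sup => // s [t /=]; rewrite in_itv/= => t0x <-.
    by apply: Sle => //; rewrite xy.
  by rewrite ler_pdivlMr ?subr_gt0//; lra.
Qed.

(** A subgradient at the right end of a chord bounds its slope from above by [shi], one at the left
    end bounds it from below by [slo]. Subgradients are controlled at interior points only; 0 and 1
    are reached by continuity. *)
Lemma subdiff_in_admissible u slo shi : KX u -> subdiff_in u slo shi ->
  admissible slo shi u.
Proof.
move=> [cu cvx] su; split => // x y x0 xy y1.
have [xyE|xlty] := eqVneq x y; first by rewrite xyE !subrr !mulr0 lexx.
have {xlty}xy : x < y by rewrite lt_neqAle xlty.
have [ci c0 c1] := (continuous_within_itvP u (@ltr01 R)).1 cu.
have upper a b : 0 <= a -> a < b -> b < 1 -> u b <= u a + shi * (b - a).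
  move=> a0 ab b1; have b01 : b \in `]0, 1[ by rewrite in_itv/=; lra.
  have [p pb] := subdiff_nonempty cvx b01.
  have /andP[_ ps] := su b p b01 pb.
  by have := pb a; rewrite in_itv/= => /(_ ltac:(lra)); nra.
have lower a b : 0 < a -> a < b -> b <= 1 -> u a <= u b - slo * (b - a).
  move=> a0 ab b1; have a01 : a \in `]0, 1[ by rewrite in_itv/=; lra.
  have [p pa] := subdiff_nonempty cvx a01.
  have /andP[ps _] := su a p a01 pa.
  by have := pa b; rewrite in_itv/= => /(_ ltac:(lra)); nra.
apply/andP; split.
- suff : u x <= u y - slo * (y - x) by lra.
  have [xgt0|] := ltP 0 x; first exact: lower.
  move=> xle0; have xE : x = 0 by lra.
  rewrite {}xE {x x0 xle0} in xy *.
  apply: (ler_cvg_to c0 (g := fun t => u y - slo * (y - t))).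
    apply: cvgB; first exact: cvg_cst.
    apply: cvgM; first exact: cvg_cst.
    apply: cvgB; first exact: cvg_cst.
    by apply: cvg_at_right_filter; exact: cvg_id.
  near=> t; apply: lower => //.
- suff : u y <= u x + shi * (y - x) by lra.
  have [ylt1|] := ltP y 1; first exact: upper.
  move=> yge1; have yE : y = 1 by lra.
  rewrite {}yE {y y1 yge1} in xy *.
  apply: (ler_cvg_to c1 (g := fun t => u x + shi * (t - x))).
    apply: cvgD; first exact: cvg_cst.
    apply: cvgM; first exact: cvg_cst.
    apply: cvgB; last exact: cvg_cst.
    by apply: cvg_at_left_filter; exact: cvg_id.
  near=> t; apply: upper => //.
Unshelve. all: by end_near. Qed.

Lemma admissible_subdiff_in u slo shi : admissible slo shi u -> subdiff_in u slo shi.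
Proof.
move=> [_ su] x p; rewrite in_itv/= => /andP[x0 x1] px.
have := px 0; rewrite in_itv/= lexx ler01 => /(_ isT).
have := px 1; rewrite in_itv/= lexx ler01 => /(_ isT).
have := su 0 x (lexx 0) (ltW x0) (ltW x1).
have := su x 1 (ltW x0) (ltW x1) (lexx 1).
move=> /andP[_ h1] /andP[h2 _] h3 h4; apply/andP; split; nra.
Qed.

Lemma KsetP ubar slo shi u : Kset ubar slo shi u <->
  admissible slo shi u /\ (forall x, x \in `[0, 1] -> u x <= ubar x).
Proof.
split=> [[Ku [uu su]]|[au uu]]; first by split => //; exact: subdiff_in_admissible.
split; last by split => //; exact: admissible_subdiff_in.
by split; [exact: admissible_continuous au|exact: au.1].
Qed.

Lemma subdiff_in_le u slo shi : convex_on_X u -> subdiff_in u slo shi -> slo <= shi.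
Proof.
move=> cu su; have h : (2^-1 : R) \in `]0, 1[ by rewrite in_itv/=; lra.
have [p pu] := subdiff_nonempty cu h.
by have /andP[] := su _ p h pu; exact: le_trans.
Qed.

Lemma affine_of_constant_derivative u s x y : {within `[0, 1], continuous u} ->
  (forall t : R, t \in `]0, 1[ -> is_derive t 1 u s) ->
  0 <= x -> x <= y -> y <= 1 -> u y - u x = s * (y - x).
Proof.
move=> cu du x0 xy y1.
have duxy (t : R) : t \in `]x, y[ -> is_derive t 1 u ((fun=> s) t).
  rewrite in_itv/= => /andP[xt ty]; apply: du.
  by rewrite in_itv/= (le_lt_trans x0 xt) (lt_le_trans ty y1).
have cuxy : {within `[x, y], continuous u}.
  apply: continuous_subspaceW cu => t /=; rewrite !in_itv/= => /andP[xt ty].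
  by rewrite (le_trans x0 xt) (le_trans ty y1).
by have [c _ ->] := MVT_segment xy duxy cuxy.
Qed.

End Subgradients.

(** * Pointwise limits along filters and ultrafilters *)

Section UltraLimits.
Context {R : realType}.
Implicit Types (u v psi ubar : R -> R) (slo shi : R).

Lemma ultra_bounded_cvg (I : Type) (F : set_system I) (f : I -> R) a b :
  UltraFilter F -> (forall i, a <= f i <= b) -> cvg (f @ F).
Proof.
move=> FU fab; have FP : ProperFilter F by exact: ultra_proper.
(* Compactness yields a cluster point [p]. It is a limit: otherwise the ultrafilter would contain
   the preimage of the complement of some neighbourhood of [p]. *)
have [|p [_ fp]] := @segment_compact R a b (f @ F) (fmap_proper_filter f FP).
  by apply: (@filterE _ F) => i; rewrite /= in_itv/= fab.
apply/cvg_ex; exists p => A pA.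
have [//|FA] := in_ultra_setVsetC (f @^-1` A) FU.
by have [y []] := fp (~` A) A FA pA.
Qed.

Context (F : set_system nat) {FF : ProperFilter F}.

Lemma admissible_cvg slo shi (w : nat -> R -> R) u :
  (forall n, admissible slo shi (w n)) ->
  (forall x, x \in `[0, 1] -> w n x @[n --> F] --> u x) ->
  admissible slo shi u.
Proof.
move=> aw wu; split=> [x y t x01 y01 t01|x y x0 xy y1].
  apply: (@ler_cvg_to nat F _ _ (fun n => w n (t * x + (1 - t) * y))
      (fun n => t * w n x + (1 - t) * w n y)).
  - by apply: wu; move: x01 y01 t01; rewrite !in_itv/=; nra.
  - by apply: cvgD; (apply: cvgM; [exact: cvg_cst|exact: wu]).
  - by apply: nearW => n; exact: (aw n).1.
have x01 : x \in `[0, 1] by rewrite in_itv/=; lra.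
have y01 : y \in `[0, 1] by rewrite in_itv/=; lra.
have cwu : w n y - w n x @[n --> F] --> u y - u x by apply: cvgB; exact: wu.
apply/andP; split.
- apply: (ler_cvg_to (cvg_cst _) cwu); apply: nearW => n.
  by case/andP: ((aw n).2 x y x0 xy y1).
- apply: (ler_cvg_to cwu (cvg_cst _)); apply: nearW => n.
  by case/andP: ((aw n).2 x y x0 xy y1).
Qed.

(** As [F] is an arbitrary proper filter, the passage to the limit goes through grid sums: being
    finite they converge along [F], and they are within [D / k.+1%:R] of [int_mu], uniformly. This
    error occurs twice, for [w n] and for [u]. *)
Lemma int_mu_cvg_ge slo shi psi (w : nat -> R -> R) u (m : R) (e : nat -> R) :
  lebesgue_measure.-integrable `[0, 1] (EFin \o psi) ->
  (forall n, admissible slo shi (w n)) ->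
  (forall x, x \in `[0, 1] -> w n x @[n --> F] --> u x) ->
  e n @[n --> F] --> 0 ->
  (forall n, m <= int_mu psi (w n) + e n) -> m <= int_mu psi u.
Proof.
move=> ipsi aw wu e0 mw.
set D := (`|slo| + `|shi|) * Rintegral lebesgue_measure `[0, 1] (fun x => `|psi x|).
have H (k : nat) : m <= int_mu psi u + 2 * D / k.+1%:R.
  have [c Hc] := int_mu_grid k ipsi.
  pose L v := \sum_(i < k.+2) c i * v (i%:R / k.+1%:R).
  have LD v : admissible slo shi v -> `|int_mu psi v - L v| <= D / k.+1%:R.
    by move=> av; apply: le_trans (Hc _ _ _ av) _; rewrite mulrAC.
  have cL : L (w n) @[n --> F] --> L u.
    rewrite /L; apply: cvg_big => [|i _]; first exact: add_continuous.
    have i01 : (i%:R / k.+1%:R : R) \in `[0, 1].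
      by rewrite in_itv/= divr_ge0//= ler_pdivrMr// mul1r ler_nat -ltnS.
    by apply: cvgM; [exact: cvg_cst|exact: wu i01].
  have cLe : L (w n) + D / k.+1%:R + e n @[n --> F] --> L u + D / k.+1%:R + 0.
    by apply: cvgD => //; apply: cvgD => //; exact: cvg_cst.
  have : m <= L u + D / k.+1%:R + 0.
    apply: (ler_cvg_to (cvg_cst _) cLe); apply: nearW => n.
    apply: le_trans (mw n) _; rewrite lerD2r.
    by have := LD _ (aw n); rewrite ler_norml => /andP[_]; rewrite lerBlDl addrC.
  have := LD _ (admissible_cvg aw wu); rewrite ler_norml -mulrA.
  by set q := D / _; lra.
apply/ler_addgt0Pr => d d0.
have D0 : 0 <= D.
  by rewrite mulr_ge0 ?addr_ge0//; apply: Rintegral_ge0.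
have Dd : 0 <= 2 * D / d by apply: divr_ge0; [exact: mulr_ge0|exact: ltW].
have /andP[_] := truncn_itv Dd.
set k := Num.trunc _; rewrite ltr_pdivrMr// => /ltW kd.
by apply: le_trans (H k) _; rewrite lerD2l ler_pdivrMr// [leRHS]mulrC.
Qed.

End UltraLimits.

(** * Existence of maximizers and the linear selection *)

Section Selection.
Context {R : realType}.
Implicit Types (u v psi ubar : R -> R) (slo shi : R).

Lemma exists_argmax ubar slo shi psi ulo :
  lebesgue_measure.-integrable `[0, 1] (EFin \o psi) ->
  Kset ubar slo shi ulo -> exists u, is_argmax ubar slo shi psi ulo u.
Proof.
move=> ipsi Kulo; have [aulo uloubar] := (KsetP _ _ _ _).1 Kulo.
pose S := [set int_mu psi v | v in Uset ubar slo shi ulo].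
have SU v : Uset ubar slo shi ulo v -> S (int_mu psi v) by exists v.
have hS : has_sup S.
  split; first by exists (int_mu psi ulo); apply: SU.
  (* The coarsest grid, with nodes 0 and 1, already bounds [int_mu] on the feasible set. *)
  have [c Hc] := int_mu_grid 0 ipsi.
  pose B x := `|ulo x| + `|ubar x|.
  exists ((`|slo| + `|shi|) / 1 * Rintegral lebesgue_measure `[0, 1] (fun x => `|psi x|)
     + \sum_(i < 2) `|c i| * B (i%:R / 1)).
  move=> _ [v [/KsetP[av vubar] ulov] <-].
  have := Hc _ _ _ av; rewrite ler_norml => /andP[_].
  rewrite lerBlDr => /le_trans; apply; rewrite lerD2l; apply: ler_sum => i _.
  apply: le_trans (ler_norm _) _; rewrite normrM ler_wpM2l//.
  have i01 : (i%:R / 1 : R) \in `[0, 1].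
    by rewrite in_itv/= divr1 ler0n/= -[leRHS]/(1%:R) ler_nat -ltnS.
  have := ulov _ i01; have := vubar _ i01; rewrite /B.
  set x := _ / _; rewrite ler_norml.
  have := ler_norm (ubar x); have := ler_norm (- ulo x); rewrite normrN.
  by have := normr_ge0 (ubar x); have := normr_ge0 (ulo x); lra.
(* An ultrafilter finer than the filter at infinity: bounded sequences converge along it, and null
   sequences still tend to 0. *)
have [F [FU ooF]] := ultraFilterLemma eventually_filter.
have /choice[w wP] (n : nat) : exists v, Uset ubar slo shi ulo v /\
    sup S - n.+1%:R^-1 < int_mu psi v.
  have n0 : 0 < (n.+1%:R^-1 : R) by rewrite invr_gt0.
  by have [_ [v Uv <-] supv] := sup_adherent n0 hS; exists v.
have aw n : admissible slo shi (w n) by have [[/KsetP[]]] := wP n.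
have wb n x : x \in `[0, 1] -> ulo x <= w n x <= ubar x.
  by move=> x01; have [[/KsetP[_ wu] uw] _] := wP n; rewrite uw// wu.
have FP : ProperFilter F by exact: ultra_proper.
pose u x := lim (w n x @[n --> F]).
have wu x : x \in `[0, 1] -> w n x @[n --> F] --> u x.
  by move=> x01; apply: (ultra_bounded_cvg (a := ulo x) (b := ubar x)) => n; exact: wb.
have au : admissible slo shi u by exact: admissible_cvg aw wu.
exists u; split.
  split; first (apply/KsetP; split=> // x x01).
    apply: (ler_cvg_to (wu x x01) (cvg_cst _)); apply: nearW => n.
    by case/andP: (wb n x x01).
  move=> x x01; apply: (ler_cvg_to (cvg_cst _) (wu x x01)); apply: nearW => n.
  by case/andP: (wb n x x01).
have cF : harmonic n @[n --> F] --> (0 : R).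
  by apply: cvg_trans cvg_harmonic; exact: cvg_app.
move=> v Uv; apply: (int_mu_cvg_ge ipsi aw wu cF) => n.
have := ltW (wP n).2; rewrite lerBlDr; apply: le_trans.
by apply: ub_le_sup; [exact: hS.2|exact: SU].
Qed.

(** Serves both endpoints. The second assumption on [ubar] says that an admissible function with the
    same value at [z] stays below it, so raising never violates the upper bound. *)
Lemma linear_selection_of_grid ubar slo shi psi z
    (nup num : {finite_measure set R -> \bar R}) :
  lebesgue_measure.-integrable `[0, 1] (EFin \o psi) -> z \in `[0, 1] ->
  (forall u, admissible slo shi u -> u z = ubar z ->
     forall x, x \in `[0, 1] -> u x <= ubar x) ->
  (forall n (c : nat -> R), exists T, optimal_raising slo shi z
     (fun u => \sum_(i < n.+2) c i * u (i%:R / n.+1%:R)) T) ->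
  linear_selection ubar slo shi psi nup num
    (fun u => Kset ubar slo shi u /\ u z = ubar z).
Proof.
move=> ipsi z01 top grid.
set D := (`|slo| + `|shi|) * Rintegral lebesgue_measure `[0, 1] (fun x => `|psi x|).
(* Optimality for the grid sum becomes near-optimality for [int_mu]; the grid error is paid once for
   [v] and once for [T u]. *)
have /choice[T TP] (n : nat) : exists T, raising slo shi z T /\
    forall u v, admissible slo shi u -> admissible slo shi v -> v z = u z ->
     (forall x, x \in `[0, 1] -> u x <= v x) ->
     int_mu psi v <= int_mu psi (T u) + 2 * D / n.+1%:R.
  have [c Hc] := int_mu_grid n ipsi; have [T [rT oT]] := grid n c.
  exists T; split => // u v au av vz uv; have := oT u v au av vz uv.
  have [aTu _ _] := rT.1 u au.
  have := Hc _ _ _ av; have := Hc _ _ _ aTu; rewrite mulrAC -/D -mulrA.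
  by set q := D / _; rewrite !ler_norml => /andP[? ?] /andP[? ?]; lra.
have aT n u : admissible slo shi u -> admissible slo shi (T n u).
  by move=> au; have [] := (TP n).1.1 u au.
have [F [FU ooF]] := ultraFilterLemma eventually_filter.
have FP : ProperFilter F by exact: ultra_proper.
(* One ultrafilter serves all [u] and [x] at once, so linearity of each [T n] survives in the
   limit. *)
pose sel u x := lim (T n u x @[n --> F]).
pose K u := Kset ubar slo shi u /\ u z = ubar z.
have Ka u : K u -> admissible slo shi u by case=> /KsetP[].
have Tb u n x : K u -> x \in `[0, 1] -> u x <= T n u x <= ubar x.
  move=> Ku x01; have [aTu Tz uT] := (TP n).1.1 u (Ka _ Ku).
  by rewrite uT//= top// Tz Ku.2.
have Tsel u x : K u -> x \in `[0, 1] -> T n u x @[n --> F] --> sel u x.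
  move=> Ku x01; apply: (ultra_bounded_cvg (a := u x) (b := ubar x)) => n.
  exact: Tb.
have asel u : K u -> admissible slo shi (sel u).
  move=> Ku; have aTu n := aT n u (Ka _ Ku); have Tu x := @Tsel u x Ku.
  exact: (admissible_cvg aTu Tu).
have selC u v a : K u -> K v -> a \in `[0, 1] ->
    forall x, x \in `[0, 1] -> sel (cvxc a u v) x = cvxc a (sel u) (sel v) x.
  move=> Ku Kv a01 x x01; apply: cvg_lim => //.
  rewrite (_ : (fun n => T n (cvxc a u v) x) =
               fun n => a * T n u x + (1 - a) * T n v x).
    by rewrite /cvxc; apply: cvgD; (apply: cvgM; [exact: cvg_cst|exact: Tsel]).
  by apply/funext => n; rewrite ((TP n).1.2 a u v a01 (Ka _ Ku) (Ka _ Kv)).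
exists sel; split=> [u Ku|]; last split=> // u v a Ku Kv a01.
- split.
    split; first (apply/KsetP; split=> [|x x01]; first exact: asel).
      apply: (ler_cvg_to (Tsel u x Ku x01) (cvg_cst _)); apply: nearW => n.
      by case/andP: (Tb u n x Ku x01).
    move=> x x01; apply: (ler_cvg_to (cvg_cst _) (Tsel u x Ku x01)).
    by apply: nearW => n; case/andP: (Tb u n x Ku x01).
  move=> v [/KsetP[av vubar] uv].
  have aTu n := aT n u (Ka _ Ku); have Tu x := @Tsel u x Ku.
  have cF : 2 * D * harmonic n @[n --> F] --> (0 : R).
    rewrite -(mulr0 (2 * D)); apply: cvgM; first exact: cvg_cst.
    by apply: cvg_trans cvg_harmonic; exact: cvg_app.
  apply: (int_mu_cvg_ge ipsi aTu Tu cF) => n.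
  apply: (TP n).2 => //; first exact: Ka.
  (* A competitor is squeezed at [z] between [u z] and [ubar z], which are equal. *)
  by apply/le_anti; rewrite uv// Ku.2 vubar.
- rewrite -(int_nu_cvxc a nup num (asel _ Ku) (asel _ Kv)) /int_nu.
  by congr (_ - _); apply: eq_Rintegral => x /set_mem x01; exact: selC.
Qed.

End Selection.

Theorem theorem3 (R : realType) (slo shi : R) (ubar : R -> R) (psi : R -> R)
  (nup num : {finite_measure set R -> \bar R}) :
  KX ubar -> subdiff_in ubar slo shi ->
  lebesgue_measure.-integrable `[0, 1] (EFin \o psi) ->
  (* (1) *)
  ((forall x : R, x \in `]0, 1[ -> is_derive x 1 ubar shi) ->
     linear_selection ubar slo shi psi nup num (Kset0 ubar slo shi)) /\
  (* (2) *)
  ((forall x : R, x \in `]0, 1[ -> is_derive x 1 ubar slo) ->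
     linear_selection ubar slo shi psi nup num (Kset1 ubar slo shi)) /\
  (* (3) nu = mu : the value function V = max is well defined and concave *)
  (exists V : (R -> R) -> R,
     (forall ulo, Kset ubar slo shi ulo ->
        (exists u, is_argmax ubar slo shi psi ulo u /\ int_mu psi u = V ulo)) /\
     (forall ulo1 ulo2 a, Kset ubar slo shi ulo1 -> Kset ubar slo shi ulo2 ->
        a \in `[0, 1] ->
        a * V ulo1 + (1 - a) * V ulo2 <= V (cvxc a ulo1 ulo2))).
Proof.
move=> [cubar vubar] subar ipsi; have ss := subdiff_in_le vubar subar.
split; [|split].
- move=> dubar; apply: linear_selection_of_grid => //.
  + by rewrite in_itv/= lexx ler01.
  (* Here [ubar] is the steepest allowed line issuing from its value at 0, so it dominates [u]. *)
  + move=> u [_ su] u0 x; rewrite in_itv/= => /andP[x0 x1].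
    have /andP[_] := su 0 x (lexx 0) x0 x1.
    by rewrite -(affine_of_constant_derivative cubar dubar)// u0 lerD2r.
  + by move=> n c; exact: grid_optimal_raising0.
- move=> dubar; apply: linear_selection_of_grid => //.
  + by rewrite in_itv/= lexx ler01.
  (* Going left from 1, the line of least slope is the highest one. *)
  + move=> u [_ su] u1 x; rewrite in_itv/= => /andP[x0 x1].
    have /andP[+ _] := su x 1 x0 x1 (lexx 1).
    by rewrite -(affine_of_constant_derivative cubar dubar)// u1 lerD2l lerN2.
  + by move=> n c; exact: grid_optimal_raising1.
have /choice[sel selP] ulo : exists u, Kset ubar slo shi ulo ->
    is_argmax ubar slo shi psi ulo u.
  have [/(exists_argmax ipsi)[u]|] := pselect (Kset ubar slo shi ulo); last by exists ulo.
  by exists u.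
exists (int_mu psi \o sel); split=> [ulo Kulo|u v a Ku Kv a01 /=].
  by exists (sel ulo); split => //; exact: selP.
have [[/KsetP[asu subaru] usu] _] := selP u Ku.
have [[/KsetP[asv subarv] vsv] _] := selP v Kv.
rewrite -(int_mu_cvxc a ipsi asu asv).
have /KsetP[au uub] := Ku; have /KsetP[av vub] := Kv.
have a0a1 : 0 <= a /\ 0 <= 1 - a by move: a01; rewrite in_itv/=; lra.
have le_cvxc (f1 g1 f2 g2 : R -> R) x : f1 x <= f2 x -> g1 x <= g2 x ->
    cvxc a f1 g1 x <= cvxc a f2 g2 x.
  by rewrite /cvxc => fg gg; apply: lerD; apply: ler_wpM2l => //; case: a0a1.
have cvxc_ubar x : cvxc a ubar ubar x = ubar x by rewrite /cvxc; ring.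
have Kuv : Kset ubar slo shi (cvxc a u v).
  apply/KsetP; split=> [|x x01]; first exact: admissible_cvxc.
  by rewrite -cvxc_ubar; apply: le_cvxc; [exact: uub|exact: vub].
(* The combination of the two maximizers is a competitor for the combined lower bound. *)
apply: (selP _ Kuv).2; split=> [|x x01].
  apply/KsetP; split=> [|x x01]; first exact: admissible_cvxc.
  by rewrite -cvxc_ubar; apply: le_cvxc; [exact: subaru|exact: subarv].
by apply: le_cvxc; [exact: usu|exact: vsv].
Qed.
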